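(* Let $(M,L)$ be a Finsler manifold in the generalized sense of the context, with domain $D(L)\subset TM$, and let $\nabla$ be a non-linear Finsler connection on $(M,L)$ with coefficients ${N^\mu}_\nu(x,y)$. Let $c(t)$ be a smooth curve in $M$ and let $Z=Z^\mu\frac{\partial}{\partial x^\mu}$ be a smooth tangent vector field on $M$ whose values along $c$ lie in $D(L)$. If $Z$ is parallel along $c$, i.e. $\nabla_{\dot c(t)}Z=0$ for all $t$, then the Finsler norm of $Z$ is conserved along $c$: $$\frac{d}{dt}\,L\big(c(t),Z(c(t))\big)=0 .$$
   Context: Convention: $M$ is a smooth manifold of dimension $n+1$ with local coordinates $(x^\mu)$, $\mu=0,\dots,n$; the induced fibre coordinates on $TM$ (written $dx^\mu$ in the paper) are denoted $y^\mu$. Repeated indices are summed. Finsler metric (generalized sense): a smooth real function $L(x,y)$ defined on an open subset $D(L)\subset TM\setminus\{0\}$ that is stable under $y\mapsto\lambda y$, $\lambda>0$, and satisfying $L(x,\lambda y)=\lambda L(x,y)$ for all $\lambda>0$. No convexity, positivity or non-degeneracy is assumed. Put $p_\alpha=\partial L/\partial y^\alpha$. Non-linear Finsler connection: given by smooth coefficient functions ${N^\alpha}_\mu(x,y)$ on $D(L)$, positively homogeneous of degree $1$ in $y$, such that on $D(L)$ $$\frac{\partial {N^\alpha}_\mu}{\partial y^\beta}=\frac{\partial {N^\alpha}_\beta}{\partial y^\mu},\qquad \frac{\partial L}{\partial x^\mu}=p_\alpha {N^\alpha}_\mu .$$ Covariant derivative: for a tangent vector field $Z$ with values in $D(L)$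 and a tangent vector $X=X^\nu\frac{\partial}{\partial x^\nu}$, $$\nabla_XZ=X^\nu\Big\{\frac{\partial Z^\mu}{\partial x^\nu}+{N^\mu}_\nu(x,Z(x))\Big\}\frac{\partial}{\partial x^\mu}.$$ *)

(* Defs.v *)
From HB Require Import structures.
From mathcomp Require Import all_boot all_order all_algebra.
From mathcomp Require Import all_classical all_reals all_analysis.

Set Implicit Arguments.
Unset Strict Implicit.
Unset Printing Implicit Defensive.

Import Order.TTheory GRing.Theory Num.Theory.
Import numFieldNormedType.Exports.

Local Open Scope classical_set_scope.
Local Open Scope ring_scope.

(* Only used for U open, where C^oo is equivalent to: all iterated directional
   derivatives exist and are Fréchet differentiable at every point of U. *)
Fixpoint Ck_on (R : realType) (V W : normedModType R) (k : nat)
    (U : set V) (f : V -> W) : Prop :=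
  match k with
  | 0%N => forall x, U x -> {for x, continuous f}
  | k'.+1 => (forall x, U x -> differentiable f x) /\
             (forall v : V, Ck_on k' U ('D_v f))
  end.

Definition smooth_on (R : realType) (V W : normedModType R)
    (U : set V) (f : V -> W) : Prop :=
  forall k : nat, Ck_on k U f.

(* [fwd] is only meaningful on [chart_dom], [bwd] only on [chart_cod]. *)
Record chart (R : realType) (n : nat) (M : topologicalType) := Chart {
  chart_dom : set M;
  chart_cod : set 'rV[R]_n.+1;
  fwd : M -> 'rV[R]_n.+1;
  bwd : 'rV[R]_n.+1 -> M;
  chart_dom_open : open chart_dom;
  chart_cod_open : open chart_cod;
  fwd_cod : forall p, chart_dom p -> chart_cod (fwd p);
  bwd_dom : forall x, chart_cod x -> chart_dom (bwd x);
  fwdK : forall p, chart_dom p -> bwd (fwd p) = p;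
  bwdK : forall x, chart_cod x -> fwd (bwd x) = x;
  fwd_continuous : forall p, chart_dom p -> {for p, continuous fwd};
  bwd_continuous : forall x, chart_cod x -> {for x, continuous bwd}
}.

Definition transition (R : realType) (n : nat) (M : topologicalType)
    (phi psi : chart R n M) : 'rV[R]_n.+1 -> 'rV[R]_n.+1 :=
  fun x => fwd psi (bwd phi x).

Definition overlap (R : realType) (n : nat) (M : topologicalType)
    (phi psi : chart R n M) : set 'rV[R]_n.+1 :=
  [set x | chart_cod phi x /\ chart_dom psi (bwd phi x)].

(* Smooth manifold of dimension n.+1. The atlas need not be maximal. *)
Record smoothManifold (R : realType) (n : nat) := SmoothManifold {
  points :> topologicalType;
  manifold_hausdorff : hausdorff_space points;
  manifold_second_countable : @second_countable points;
  atlas : set (chart R n points);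
  atlas_cover : forall p : points,
    exists phi, atlas phi /\ chart_dom phi p;
  atlas_smooth : forall phi psi, atlas phi -> atlas psi ->
    smooth_on (overlap phi psi) (transition phi psi)
}.

Definition chart_at (R : realType) (n : nat) (M : smoothManifold R n) (p : M)
    : chart R n M :=
  projT1 (cid (atlas_cover p)).

(* A tangent vector at p is stored as its components in the reference chart
   [chart_at p]; its components in any other chart around p are given by
   [components], i.e. by the usual transformation rule. *)
Definition tangent (R : realType) (n : nat) (M : smoothManifold R n) (p : M)
    : Type := 'rV[R]_n.+1.

Definition components (R : realType) (n : nat) (M : smoothManifold R n)
    (phi : chart R n M) (p : M) (v : tangent p) : 'rV[R]_n.+1 :=
  'd (transition (chart_at p) phi) (fwd (chart_at p) p) (v : 'rV[R]_n.+1).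

(* y^mu d/dx^mu at the point with coordinates x in the chart phi;
   inverse of [components phi]. *)
Definition tvect (R : realType) (n : nat) (M : smoothManifold R n)
    (phi : chart R n M) (x y : 'rV[R]_n.+1) : tangent (bwd phi x) :=
  'd (transition phi (chart_at (bwd phi x))) x y.

(* A subset of TM, and a function on TM, in the induced coordinates (x, y). *)
Definition tm_set (R : realType) (n : nat) (M : smoothManifold R n)
    (D : forall p : M, set (tangent p)) (phi : chart R n M)
    : set ('rV[R]_n.+1 * 'rV[R]_n.+1) :=
  [set z | chart_cod phi z.1 /\ D (bwd phi z.1) (tvect phi z.1 z.2)].

Definition tm_fun (R : realType) (n : nat) (M : smoothManifold R n)
    (L : forall p : M, tangent p -> R) (phi : chart R n M)
    (z : 'rV[R]_n.+1 * 'rV[R]_n.+1) : R :=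
  L (bwd phi z.1) (tvect phi z.1 z.2).

Definition unit_vec (R : realType) (n : nat) (mu : 'I_n.+1) : 'rV[R]_n.+1 :=
  delta_mx 0 mu.

Definition pd (R : realType) (n : nat) (mu : 'I_n.+1) (f : 'rV[R]_n.+1 -> R)
    (x : 'rV[R]_n.+1) : R :=
  'D_(unit_vec R mu) f x.

Definition pdx (R : realType) (n : nat) (mu : 'I_n.+1)
    (f : 'rV[R]_n.+1 * 'rV[R]_n.+1 -> R) (z : 'rV[R]_n.+1 * 'rV[R]_n.+1) : R :=
  'D_((unit_vec R mu, 0) : 'rV[R]_n.+1 * 'rV[R]_n.+1) f z.

Definition pdy (R : realType) (n : nat) (mu : 'I_n.+1)
    (f : 'rV[R]_n.+1 * 'rV[R]_n.+1 -> R) (z : 'rV[R]_n.+1 * 'rV[R]_n.+1) : R :=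
  'D_((0, unit_vec R mu) : 'rV[R]_n.+1 * 'rV[R]_n.+1) f z.

(* [fL] is only meaningful on [fdom], the domain D(L). *)
Record finslerMetric (R : realType) (n : nat) (M : smoothManifold R n) :=
  FinslerMetric {
  fdom : forall p : M, set (tangent p);
  fL : forall p : M, tangent p -> R;
  fdom_neq0 : forall (p : M) (v : tangent p),
    fdom v -> (v : 'rV[R]_n.+1) != 0;
  fdom_open : forall phi, atlas phi -> open (tm_set fdom phi);
  fdom_scale : forall (p : M) (v : tangent p) (lambda : R),
    0 < lambda -> fdom v -> @fdom p (lambda *: (v : 'rV[R]_n.+1));
  fL_smooth : forall phi, atlas phi ->
    smooth_on (tm_set fdom phi) (tm_fun fL phi);
  fL_homogeneous : forall (p : M) (v : tangent p) (lambda : R),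
    0 < lambda -> fdom v ->
    @fL p (lambda *: (v : 'rV[R]_n.+1)) = lambda * fL v
}.

(* [ncoef phi (x, y) alpha mu] is N^alpha_mu(x, y) in the chart phi. The law
   [ncoef_change], with y' = (dx'/dx) y,
     N'^a_b(x',y') dx'^b/dx^nu
       = dx'^a/dx^mu N^mu_nu(x,y) - y^mu d^2x'^a/(dx^nu dx^mu),
   is the one making the covariant derivative independent of the chart. *)
Record finslerConnection (R : realType) (n : nat) (M : smoothManifold R n)
    (F : finslerMetric M) := FinslerConnection {
  ncoef : chart R n M -> 'rV[R]_n.+1 * 'rV[R]_n.+1 -> 'M[R]_n.+1;
  ncoef_smooth : forall phi, atlas phi -> forall alpha mu,
    smooth_on (tm_set (@fdom _ _ _ F) phi) (fun z => ncoef phi z alpha mu);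
  ncoef_homogeneous : forall phi, atlas phi -> forall x y (lambda : R),
    0 < lambda -> tm_set (@fdom _ _ _ F) phi (x, y) -> forall alpha mu,
    ncoef phi (x, lambda *: y) alpha mu = lambda * ncoef phi (x, y) alpha mu;
  ncoef_change : forall phi psi, atlas phi -> atlas psi -> forall x y,
    overlap phi psi x -> tm_set (@fdom _ _ _ F) phi (x, y) ->
    let x' := transition phi psi in
    forall a nu : 'I_n.+1,
    \sum_b ncoef psi (x' x, 'd x' x y) a b * pd nu (fun u => x' u 0 b) x =
    \sum_mu pd mu (fun u => x' u 0 a) x * ncoef phi (x, y) mu nu
    - \sum_mu y 0 mu * pd nu (pd mu (fun u => x' u 0 a)) x;
  ncoef_symmetric : forall phi, atlas phi ->
    forall z, tm_set (@fdom _ _ _ F) phi z -> forall alpha mu beta : 'I_n.+1,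
    pdy beta (fun w => ncoef phi w alpha mu) z =
    pdy mu (fun w => ncoef phi w alpha beta) z;
  ncoef_metric : forall phi, atlas phi ->
    forall z, tm_set (@fdom _ _ _ F) phi z -> forall mu : 'I_n.+1,
    pdx mu (tm_fun (@fL _ _ _ F) phi) z =
    \sum_alpha pdy alpha (tm_fun (@fL _ _ _ F) phi) z * ncoef phi z alpha mu
}.

Definition field_components (R : realType) (n : nat) (M : smoothManifold R n)
    (Z : forall p : M, tangent p) (phi : chart R n M) (x : 'rV[R]_n.+1)
    : 'rV[R]_n.+1 :=
  components phi (Z (bwd phi x)).

Definition smooth_vector_field (R : realType) (n : nat)
    (M : smoothManifold R n) (Z : forall p : M, tangent p) : Prop :=
  forall phi, atlas phi -> smooth_on (chart_cod phi) (field_components Z phi).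

(* The covariant derivative nabla_X Z at p, computed in [chart_at p]: this is
   the chart in which the components of X and of the result are stored. *)
Definition nabla (R : realType) (n : nat) (M : smoothManifold R n)
    (F : finslerMetric M) (N : finslerConnection F) (p : M) (X : tangent p)
    (Z : forall q : M, tangent q) : tangent p :=
  let phi := chart_at p in
  let x := fwd phi p in
  let Zphi := field_components Z phi in
  \row_mu \sum_nu (X : 'rV[R]_n.+1) 0 nu *
    (pd nu (fun u => Zphi u 0 mu) x + ncoef N phi (x, Zphi x) mu nu).

Definition smooth_curve (R : realType) (n : nat) (M : smoothManifold R n)
    (I : set R) (c : R -> M) : Prop :=
  (forall t, I t -> {for t, continuous c}) /\
  (forall phi, atlas phi ->
    smooth_on (I `&` [set t | chart_dom phi (c t)]) (fun t => fwd phi (c t))).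

Definition velocity (R : realType) (n : nat) (M : smoothManifold R n)
    (c : R -> M) (t : R) : tangent (c t) :=
  derive1 (fun s => fwd (chart_at (c t)) (c s)) t.

(* Main.v *)
Require Import Defs.
From HB Require Import structures.
From mathcomp Require Import all_boot all_order all_algebra.
From mathcomp Require Import all_classical all_reals all_analysis.
Set Implicit Arguments.
Unset Strict Implicit.

Import Order.TTheory GRing.Theory Num.Theory.
Import numFieldNormedType.Exports.
Local Open Scope classical_set_scope.
Local Open Scope ring_scope.

(** In the chart [chart_at (c t)], write x(s) for the coordinates of c(s) and
    z^a(x) for the components of Z. Then L(Z(c s)) = L(x(s), z(x(s))) near t
    and, by the chain rule and dL/dx^mu = p_a N^a_mu, its derivative is
    p_a (dx^mu/ds) (d_mu z^a + N^a_mu), the pairing of p with nabla_{c'} Z. *)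

Lemma smooth_on_differentiable (R : realType) (V W : normedModType R)
    (U : set V) (f : V -> W) (x : V) :
  smooth_on U f -> U x -> differentiable f x.
Proof. by move=> /(_ 1%N) [+ _]; exact. Qed.

(** At a point of differentiability ['d] gives the directional derivatives, and these depend only on
    the germ. This serves for identities between transition maps, which hold only on an overlap. *)
Lemma near_eq_diff (R : realType) (V W : normedModType R) (f g : V -> W)
    (x : V) :
  (\near x, f x = g x) -> differentiable f x -> differentiable g x ->
  'd f x = 'd g x :> (V -> W).
Proof.
move=> fg df dg; apply/funext => v.
by rewrite -!deriveE//; exact: near_eq_derive.
Qed.

(** The chain rule through s |-> (f s, g (f s)). It is meant for [f] the coordinates of the curve,
    [g] the components of the field and [h] the metric in a chart. *)
Lemma diff_comp_graph (R : realType) (U V W X : normedModType R) (f : U -> V)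
    (g : V -> W) (h : V * W -> X) (t u : U) :
  differentiable f t -> differentiable g (f t) ->
  differentiable h (f t, g (f t)) ->
  differentiable (fun s => h (f s, g (f s))) t /\
  'd (fun s => h (f s, g (f s))) t u =
    'd h (f t, g (f t)) ('d f t u, 'd g (f t) ('d f t u)).
Proof.
move=> df dg dh.
have dgf : differentiable (g \o f) t by exact: differentiable_comp.
have dp : differentiable (fun s => (f s, (g \o f) s)) t.
  exact: differentiable_pair.
split; first exact: (differentiable_comp dp dh).
have -> : (fun s => h (f s, g (f s))) = h \o (fun s => (f s, (g \o f) s)) by [].
by rewrite (diff_comp dp dh) /= (diff_pair df dgf) (diff_comp df dg).
Qed.

Lemma atlas_chart_at (R : realType) (n : nat) (M : smoothManifold R n)
    (p : M) : atlas (chart_at p).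
Proof. by rewrite /chart_at; case: cid => phi []. Qed.

Lemma chart_at_dom (R : realType) (n : nat) (M : smoothManifold R n)
    (p : M) : chart_dom (chart_at p) p.
Proof. by rewrite /chart_at; case: cid => phi []. Qed.

Lemma near_overlap (R : realType) (n : nat) (M : topologicalType)
    (phi psi : chart R n M) (x : 'rV[R]_n.+1) :
  overlap phi psi x -> \near x, overlap phi psi x.
Proof.
move=> [phix psix]; near=> u; split; near: u.
  by apply: open_nbhs_nbhs; split=> //; exact: chart_cod_open.
apply: (bwd_continuous phix).
by apply: open_nbhs_nbhs; split=> //; exact: chart_dom_open.
Unshelve. all: by end_near. Qed.

Lemma transitionK (R : realType) (n : nat) (M : topologicalType)
    (phi psi : chart R n M) (x : 'rV[R]_n.+1) :
  overlap phi psi x -> transition psi phi (transition phi psi x) = x.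
Proof. by move=> [phix psix]; rewrite /transition fwdK// bwdK. Qed.

Lemma transition_overlap (R : realType) (n : nat) (M : topologicalType)
    (phi psi : chart R n M) (x : 'rV[R]_n.+1) :
  overlap phi psi x -> overlap psi phi (transition phi psi x).
Proof.
move=> [phix psix]; split; first exact: fwd_cod.
by rewrite /transition fwdK//; exact: bwd_dom.
Qed.

(** The two transitions compose to the identity on the overlap, a neighbourhood of x, so the chain
    rule makes their differentials compose to the identity as well. *)
Lemma diff_transitionK (R : realType) (n : nat) (M : smoothManifold R n)
    (phi psi : chart R n M) (x v : 'rV[R]_n.+1) :
  atlas phi -> atlas psi -> overlap phi psi x ->
  'd (transition psi phi) (transition phi psi x) ('d (transition phi psi) x v)
  = v.
Proof.
move=> Mphi Mpsi ox.
have df : differentiable (transition phi psi) x.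
  exact: smooth_on_differentiable (atlas_smooth Mphi Mpsi) ox.
have dg : differentiable (transition psi phi) (transition phi psi x).
  exact: smooth_on_differentiable (atlas_smooth Mpsi Mphi)
    (transition_overlap ox).
rewrite -[LHS]/(('d (transition psi phi) (transition phi psi x) \o
  'd (transition phi psi) x) v) -diff_comp//.
have -> : 'd (transition psi phi \o transition phi psi) x
    = 'd (@id 'rV[R]_n.+1) x :> ('rV[R]_n.+1 -> 'rV[R]_n.+1).
  apply: near_eq_diff; last 2 first.
  - exact: differentiable_comp.
  - by [].
  near=> u; apply: transitionK; near: u; exact: near_overlap.
by rewrite diff_val.
Unshelve. all: by end_near. Qed.

Lemma tvect_components (R : realType) (n : nat) (M : smoothManifold R n)
    (phi : chart R n M) (x : 'rV[R]_n.+1) (v : tangent (bwd phi x)) :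
  atlas phi -> chart_cod phi x -> tvect phi x (components phi v) = v.
Proof.
move=> Mphi phix; set psi := chart_at (bwd phi x).
have psix : chart_dom psi (bwd phi x) by exact: chart_at_dom.
have o : overlap phi psi x by split.
(* [components] goes from the reference chart [psi] to [phi] and [tvect] comes back, so the base
   point is the image of x in [psi]. *)
have := diff_transitionK v (atlas_chart_at _) Mphi (transition_overlap o).
by rewrite transitionK.
Qed.

(* Stated for a polymorphic [G], since [Z q] and the tangent vector rebuilt
   from its coordinates live in the distinct types [tangent q] and
   [tangent (bwd phi (fwd phi q))]. *)
Lemma tvect_field_components (R : realType) (n : nat) (M : smoothManifold R n)
    (T : Type) (G : forall p : M, tangent p -> T)
    (Z : forall p : M, tangent p) (phi : chart R n M) (q : M) :
  atlas phi -> chart_dom phi q ->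
  G (bwd phi (fwd phi q)) (tvect phi (fwd phi q) (field_components Z phi (fwd phi q)))
  = G q (Z q).
Proof.
move=> Mphi phiq; rewrite /field_components tvect_components//.
  by rewrite fwdK.
exact: fwd_cod.
Qed.

Lemma diff_pd (R : realType) (n : nat) (f : 'rV[R]_n.+1 -> R)
    (x v : 'rV[R]_n.+1) :
  differentiable f x -> 'd f x v = \sum_mu v 0 mu * pd mu f x.
Proof.
move=> df; rewrite [in LHS](row_sum_delta v) linear_sum.
by apply: eq_bigr => mu _; rewrite linearZ /pd deriveE.
Qed.

Lemma diff_pdx_pdy (R : realType) (n : nat)
    (f : 'rV[R]_n.+1 * 'rV[R]_n.+1 -> R) (z v : 'rV[R]_n.+1 * 'rV[R]_n.+1) :
  differentiable f z ->
  'd f z v = \sum_mu v.1 0 mu * pdx mu f z + \sum_mu v.2 0 mu * pdy mu f z.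
Proof.
move=> df; rewrite /pdx /pdy.
(* Only the argument of the differential is expanded in the base and fibre directions; the
   coordinates of v on the right stay. *)
have {1}-> : v = \sum_mu v.1 0 mu *: (unit_vec R mu, 0 : 'rV[R]_n.+1)
            + \sum_mu v.2 0 mu *: (0 : 'rV[R]_n.+1, unit_vec R mu).
  rewrite [LHS]surjective_pairing [RHS]surjective_pairing; congr pair => /=.
    rewrite !(big_morph fst (id1 := 0) (op1 := +%R))//= addrC big1 ?add0r.
      exact: row_sum_delta.
    by move=> mu _; rewrite scaler0.
  rewrite !(big_morph snd (id1 := 0) (op1 := +%R))//= big1 ?add0r.
    exact: row_sum_delta.
  by move=> mu _; rewrite scaler0.
rewrite linearD !linear_sum; congr (_ + _);
  by [apply: eq_bigr => mu _; rewrite linearZ deriveE].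
Qed.

(** A matrix entry is a continuous linear function of the matrix, hence its own differential at
    every point. *)
Lemma diff_coord (R : realType) (m n : nat) (A : 'M[R]_(m, n)) (i : 'I_m)
    (j : 'I_n) :
  'd (fun B : 'M[R]_(m, n) => B i j) A = (fun B => B i j) :> ('M[R]_(m, n) -> R).
Proof.
pose g (B : 'M[R]_(m, n)) : R := B i j.
have lin_g : linear g by move=> k B C; rewrite /g !mxE.
pose gL : {linear 'M[R]_(m, n) -> R} :=
  HB.pack g (GRing.isLinear.Build _ _ _ _ g lin_g).
by apply: (diff_lin A (f := gL)); exact: coord_continuous.
Qed.

Lemma diff_coordE (R : realType) (n : nat) (f : 'rV[R]_n.+1 -> 'rV[R]_n.+1)
    (x v : 'rV[R]_n.+1) (a : 'I_n.+1) :
  differentiable f x ->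
  ('d f x v : 'rV[R]_n.+1) 0 a = \sum_nu v 0 nu * pd nu (fun u => f u 0 a) x.
Proof.
move=> df; pose g := fun y : 'rV[R]_n.+1 => y 0 a.
have dg y : differentiable g y by exact: differentiable_coord.
rewrite -(@diff_pd _ _ (g \o f)); last exact: differentiable_comp.
by rewrite (diff_comp df (dg _)) /g diff_coord.
Qed.

Theorem mainTheorem1 (R : realType) (n : nat) (M : smoothManifold R n)
    (F : finslerMetric M) (N : finslerConnection F)
    (I : set R) (I_open : open I) (I_interval : is_interval I)
    (c : R -> M) (c_smooth : smooth_curve I c)
    (Z : forall p : M, tangent p) (Z_smooth : smooth_vector_field Z)
    (Z_dom : forall t, I t -> fdom F (Z (c t)))
    (Z_parallel : forall t, I t ->
       nabla N (velocity c t) Z = (0 : 'rV[R]_n.+1)) :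
  forall t, I t -> is_derive t 1 (fun s : R => fL F (Z (c s))) 0.
Proof.
move=> t It; set phi := chart_at (c t).
have Mphi : atlas phi := atlas_chart_at (c t).
have phit : chart_dom phi (c t) := chart_at_dom (c t).
pose x s := fwd phi (c s).
pose z := field_components Z phi.
pose L := tm_fun (fL F) phi.
have dx : differentiable x t.
  by apply: smooth_on_differentiable (c_smooth.2 phi Mphi) _.
have dz : differentiable z (x t).
  by apply: smooth_on_differentiable (Z_smooth phi Mphi) _; exact: fwd_cod.
(* In the chart this pair represents Z(c t); the transport lemma is applied with [G] the predicate
   [fdom F]. *)
have domt : tm_set (fdom F) phi (x t, z (x t)).
  split; first exact: fwd_cod.
  by rewrite tvect_field_components//; exact: Z_dom.
have dL : differentiable L (x t, z (x t)).
  exact: smooth_on_differentiable (fL_smooth F Mphi) domt.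
(* The coordinate expression equals the norm as long as c(s) stays in the domain of [phi], which
   continuity of c ensures for s near t. *)
apply: (@near_eq_is_derive _ _ _ (fun s => L (x s, z (x s)))).
  near=> s; apply: (@tvect_field_components _ _ _ _ (fL F)) => //.
  near: s; apply: (c_smooth.1 t It).
  by apply: open_nbhs_nbhs; split=> //; exact: chart_dom_open.
have [dcomp dcompE] := diff_comp_graph (1 : R) dx dz dL.
apply: DeriveDef; first exact: diff_derivable.
rewrite deriveE// dcompE.
set xd := 'd x t 1.
(* [velocity] and [nabla] are both computed in [chart_at (c t)], which is [phi], so no change of
   chart intervenes. *)
have xdE : xd = velocity c t by rewrite /xd -derive1E'.
rewrite diff_pdx_pdy//=.
(* The metric condition turns the base part into a double sum; with the fibre index a outermost, the
   summand for each a vanishes separately. *)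
under eq_bigr => mu _ do rewrite (ncoef_metric N Mphi domt) mulr_sumr.
rewrite exchange_big -big_split big1//= => a _.
rewrite diff_coordE// mulr_suml -big_split/=.
have := congr1 (fun v : 'rV[R]_n.+1 => v 0 a) (Z_parallel t It).
rewrite /nabla !mxE -xdE => na.
(* The factor 0 is then replaced by the a-th component of the covariant derivative, and the two
   sides agree term by term in nu. *)
transitivity (pdy a L (x t, z (x t)) * 0); last exact: mulr0.
rewrite -[in RHS]na mulr_sumr; apply: eq_bigr => nu _.
by rewrite -mulrA -mulrDr -mulrCA [X in _ * (_ + X)]mulrC -mulrDr [in LHS]addrC.
Unshelve. all: by end_near. Qed.
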